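(* Let $M$ be a monoid and $N$ a u.p. monoid. If $R$ is a $2$-primal $M$-Armendariz ring, then the monoid ring $R[N]$ is a lower nil $M$-Armendariz ring.
   Context: Rings are associative with identity. For a ring $R$, $N_*(R)$ denotes the prime radical (lower nilradical) and $N(R)$ the set of nilpotent elements; $R$ is $2$-primal if $N_*(R)=N(R)$. A monoid $N$ is a u.p. monoid (unique product monoid) if for any two nonempty finite subsets $A,B$ of $N$ there exists an element $g\in N$ that can be written uniquely in the form $g=ab$ with $a\in A$, $b\in B$. For a monoid $M$, $R[M]$ is the monoid ring of $M$ over $R$; for a subset $J\subseteq R$, $J[M]$ is the set of elements of $R[M]$ all of whose coefficients lie in $J$. Below, elements of $R[M]$ are written $\alpha=a_1g_1+\cdots+a_ng_n$ and $\beta=b_1h_1+\cdots+b_mh_m$ with $a_i,b_j\in R$, the $g_i\in M$ pairwise distinct and the $h_j\in M$ pairwise distinct. A ring $R$ is $M$-Armendariz if $\alpha\beta=0$ implies $a_ib_j=0$ for all $i,j$. A ring $R$ is lower nil $M$-Armendariz if $\alpha\beta\in N_*(R)[M]$ implies $a_ib_j\in N_*(R)$ for all $i,j$. *)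

(* Defs.v *)
From HB Require Import structures.
From mathcomp Require Import all_boot all_algebra finmap.
From mathcomp.multinomials Require Import monalg.

Set Implicit Arguments.
Unset Strict Implicit.
Unset Printing Implicit Defensive.

Import GRing.Theory.

Local Open Scope ring_scope.
Local Open Scope fset_scope.

(* [{malg R[M]}] is the additive group of finitely supported functions from [M]
   to [R]; [a@_g] is the coefficient of [g] in [a].  Its library ring structure
   needs [M : monomType], which demands that [x * y = 1] imply [x = y = 1]; the
   alias below carries the convolution product of an arbitrary monoid. *)
Definition monoid_ring (R : pzRingType) (M : monoidType) : Type := {malg R[M]}.

Section MonoidRing.
Context (R : pzRingType) (M : monoidType).
Local Notation RM := (monoid_ring R M).
Implicit Types (a b c : RM) (x y : R) (g h : M).

HB.instance Definition _ := GRing.Zmodule.on RM.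

Definition monoid_ring_one : RM := << 1 *g 1%g >>.

Definition monoid_ring_mul a b : RM :=
  \sum_(g <- msupp a) \sum_(h <- msupp b) << a@_g * b@_h *g (g * h)%g >>.

Local Notation one := monoid_ring_one.
Local Notation mul := monoid_ring_mul.

Lemma monoid_ring_mulw (d1 d2 : {fset M}) a b :
  msupp a `<=` d1 -> msupp b `<=` d2 ->
  mul a b = \sum_(g <- d1) \sum_(h <- d2) << a@_g * b@_h *g (g * h)%g >>.
Proof.
move=> le1 le2; rewrite /mul (big_fset_incl _ le1) /=.
  apply/eq_bigr=> g _; apply/big_fset_incl => // h _ /mcoeff_outdom ->.
  by rewrite mulr0 monalgU0.
move=> g _ /mcoeff_outdom ag.
by rewrite big1 // => h _; rewrite ag mul0r monalgU0.
Qed.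

Lemma monoid_ring_mulUU x y g h :
  mul << x *g g >> << y *g h >> = << x * y *g (g * h)%g >>.
Proof. by rewrite (monoid_ring_mulw msuppU_le msuppU_le) !big_seq_fset1 !mcoeffUU. Qed.

Lemma monoid_ring_mulDl : left_distributive mul +%R.
Proof.
move=> a b c.
rewrite [in RHS](monoid_ring_mulw (fsubsetUl _ (msupp b)) (fsubset_refl _)).
rewrite [in RHS](monoid_ring_mulw (fsubsetUr (msupp a) _) (fsubset_refl _)).
rewrite (monoid_ring_mulw (msuppD_le _ _) (fsubset_refl _)).
rewrite -big_split /=; apply/eq_bigr=> g _.
rewrite -big_split /=; apply/eq_bigr=> h _.
by rewrite mcoeffD mulrDl monalgUD.
Qed.

Lemma monoid_ring_mulDr : right_distributive mul +%R.
Proof.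
move=> c a b.
rewrite [in RHS](monoid_ring_mulw (fsubset_refl _) (fsubsetUl _ (msupp b))).
rewrite [in RHS](monoid_ring_mulw (fsubset_refl _) (fsubsetUr (msupp a) _)).
rewrite (monoid_ring_mulw (fsubset_refl _) (msuppD_le _ _)).
rewrite -big_split /=; apply/eq_bigr=> g _.
rewrite -big_split /=; apply/eq_bigr=> h _.
by rewrite mcoeffD mulrDr monalgUD.
Qed.

Lemma monoid_ring_mul0l : left_zero 0 mul.
Proof. by move=> a; rewrite /mul msupp0 big_seq_fset0. Qed.

Lemma monoid_ring_mul0r : right_zero 0 mul.
Proof. by move=> a; rewrite /mul big1 // => g _; rewrite msupp0 big_seq_fset0. Qed.

Lemma monoid_ring_mul1l : left_id one mul.
Proof.
move=> a; rewrite (monoid_ring_mulw msuppU_le (fsubset_refl _)) big_seq_fset1.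
rewrite [RHS]monalgE; apply/eq_bigr=> g _.
by rewrite mcoeffUU mul1r mul1g.
Qed.

Lemma monoid_ring_mul1r : right_id one mul.
Proof.
move=> a; rewrite (monoid_ring_mulw (fsubset_refl _) msuppU_le).
rewrite [RHS]monalgE; apply/eq_bigr=> g _.
by rewrite big_seq_fset1 mcoeffUU mulr1 mulg1.
Qed.

Lemma monoid_ring_mulA : associative mul.
Proof.
have suml I (r : seq I) (F : I -> RM) b :
    mul (\sum_(i <- r) F i) b = \sum_(i <- r) mul (F i) b.
  by elim/big_rec2: _ => [|i u v _ <-];
    [exact: monoid_ring_mul0l | exact: monoid_ring_mulDl].
have sumr I (r : seq I) (F : I -> RM) b :
    mul b (\sum_(i <- r) F i) = \sum_(i <- r) mul b (F i).
  by elim/big_rec2: _ => [|i u v _ <-];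
    [exact: monoid_ring_mul0r | exact: monoid_ring_mulDr].
have sumE a : a = \sum_(g <- msupp a) (<< a@_g *g g >> : RM) := monalgE a.
move=> a b c; rewrite [a]sumE [b]sumE [c]sumE.
rewrite !suml; apply: eq_bigr => g _.
rewrite [in RHS](sumr _ _ _ << a@_g *g g >>) suml sumr.
apply: eq_bigr => h _; rewrite !sumr; apply: eq_bigr => k _.
by rewrite !monoid_ring_mulUU mulrA mulgA.
Qed.

HB.instance Definition _ := GRing.Zmodule_isPzRing.Build RM
  monoid_ring_mulA monoid_ring_mul1l monoid_ring_mul1r
  monoid_ring_mulDl monoid_ring_mulDr.

End MonoidRing.

Definition up_monoid (N : monoidType) : Prop :=
  forall A B : {fset N}, A != fset0 -> B != fset0 ->
  exists g : N, exists! ab : N * N,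
    [/\ ab.1 \in A, ab.2 \in B & g = (ab.1 * ab.2)%g].

Section Radicals.
Context (R : pzRingType).

Definition two_sided_ideal (I : R -> Prop) : Prop :=
  [/\ I 0, (forall x y, I x -> I y -> I (x - y)),
      (forall r x, I x -> I (r * x)) & (forall r x, I x -> I (x * r))].

(* Since [P] is closed under sums, "[x * y] is in [P] for all [x] in [I] and
   [y] in [J]" says that the product ideal [IJ] is contained in [P]. *)
Definition prime_ideal (P : R -> Prop) : Prop :=
  [/\ two_sided_ideal P, ~ P 1 &
      forall I J : R -> Prop, two_sided_ideal I -> two_sided_ideal J ->
        (forall x y, I x -> J y -> P (x * y)) ->
        (forall x, I x -> P x) \/ (forall x, J x -> P x)].

Definition prime_radical (x : R) : Prop := forall P, prime_ideal P -> P x.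

Definition nilpotent_elt (x : R) : Prop := exists n : nat, x ^+ n = 0.

Definition two_primal : Prop := forall x, prime_radical x <-> nilpotent_elt x.

End Radicals.

(* In a sum [a_1 g_1 + ... + a_n g_n] with distinct [g_i], the [a_i] are the
   coefficients at the [g_i] and every other coefficient is [0]; quantifying
   over all of [M] therefore only adds products with a zero factor. *)
Definition Armendariz (M : monoidType) (R : pzRingType) : Prop :=
  forall a b : monoid_ring R M, a * b = 0 -> forall g h : M, a@_g * b@_h = 0.

Definition lower_nil_Armendariz (M : monoidType) (R : pzRingType) : Prop :=
  forall a b : monoid_ring R M,
  (forall k : M, prime_radical (a * b)@_k) ->
  forall g h : M, prime_radical (a@_g * b@_h).

(* Main.v *)
Require Import Defs.
From mathcomp Require Import all_boot all_algebra.
From mathcomp Require Import finmap.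
From mathcomp.multinomials Require Import monalg.
From mathcomp.classical Require boolp classical_sets.

(** Write [J] for the prime radical of [R], and [J[M]] for the elements of
    [R[M]] whose coefficients lie in [J].

    Every prime ideal of [R[M]] contracts to a prime ideal of [R], so [J[M]]
    lies in the prime radical of [R[M]] ([prime_radical_coefs]), which consists
    of nilpotent elements ([prime_radical_nilpotent], by Zorn's lemma).  Hence
    if [a * b] is in [J[M]], some power [(a * b) ^+ n] is zero.  An Armendariz
    ring turns a vanishing product of any number of factors into vanishing
    products of coefficients, so [(a@_g * b@_h) ^+ n = 0], and 2-primality puts
    [a@_g * b@_h] in [J]: a 2-primal Armendariz ring is lower nil Armendariz
    ([two_primal_lower_nil_Armendariz]).

    The second ingredient is that reduced rings are Armendariz over u.p. monoids,
    here relative to an ideal [K] of a ring [T] for which [T / K] is reduced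
    ([up_Armendariz_mod]).  It is used twice.  With [T = R] and [K = J] it makes
    [R[N] / J[N]] reduced, so the prime radical of [R[N]] is exactly [J[N]].
    With [T = R[M]] and [K = J[M]] it applies to [R[M][N]]: that [R[M] / J[M]] is
    reduced is the case [a = b], [g = h] of the previous paragraph.

    Finally [R[N][M]] and [R[M][N]] are isomorphic by exchanging the two
    exponents ([malg_swap]).  If [a * b] has its coefficients in the prime radical
    [J[N]] of [R[N]], the swapped product lies in [J[M][N]]; the u.p. argument
    separates the exponents in [N], the lower nil Armendariz property of [R]
    those in [M], and so [a@_g@_s * b@_h@_t] is in [J] for all [g], [h], [s],
    [t]. *)

Set Implicit Arguments.
Unset Strict Implicit.
Unset Printing Implicit Defensive.

Import GRing.Theory.

Local Open Scope fset_scope.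
Local Open Scope ring_scope.

(** * Ideals and prime ideals *)

Section Ideals.
Context (R : pzRingType) (I : R -> Prop) (idI : two_sided_ideal I).

Lemma ideal0 : I 0. Proof. by case: idI. Qed.

Lemma idealB x y : I x -> I y -> I (x - y).
Proof. by case: idI => _ + _ _; apply. Qed.

Lemma idealMl r x : I x -> I (r * x).
Proof. by case: idI => _ _ + _; apply. Qed.

Lemma idealMr r x : I x -> I (x * r).
Proof. by case: idI => _ _ _; apply. Qed.

Lemma idealD x y : I x -> I y -> I (x + y).
Proof.
move=> Ix Iy; rewrite -[y]opprK; apply: idealB => //.
by rewrite -[- y]add0r; apply: idealB => //; apply: ideal0.
Qed.

Lemma ideal_mulrb x (c : bool) : (c -> I x) -> I (x *+ c).
Proof. by case: c => [/(_ isT)|_]; rewrite ?mulr0n //; apply: ideal0. Qed.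

Lemma ideal_sum (T : eqType) (r : seq T) (F : T -> R) :
  (forall i, i \in r -> I (F i)) -> I (\sum_(i <- r) F i).
Proof.
move=> IF; rewrite big_seq.
by elim/big_ind: _ => [|x y|i /IF //]; [apply: ideal0 | apply: idealD].
Qed.

Lemma ideal_sum_isolate (T : choiceType) (A : {fset T}) (F : T -> R) i :
  i \in A -> (forall j, j != i -> I (F j)) -> I (\sum_(j <- A) F j) -> I (F i).
Proof.
move=> Ai IF; rewrite (big_fsetD1 i) //= => Isum.
rewrite -[F i](addrK (\sum_(j <- A `\ i) F j)); apply: idealB => //.
by apply: ideal_sum => j /fsetD1P[/IF].
Qed.

End Ideals.

Lemma ideal_add (R : pzRingType) (I J : R -> Prop) :
  two_sided_ideal I -> two_sided_ideal J ->
  two_sided_ideal (fun z : R => exists x y : R, [/\ I x, J y & z = x + y]).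
Proof.
move=> idI idJ; split.
- by exists 0, 0; split; [apply: ideal0 | apply: ideal0 | rewrite addr0].
- move=> _ _ [x [y [Ix Jy ->]]] [x' [y' [Ix' Jy' ->]]].
  exists (x - x'), (y - y'); split; [exact: idealB | exact: idealB |].
  by rewrite opprD addrACA.
- move=> r _ [x [y [Ix Jy ->]]]; exists (r * x), (r * y).
  by split; [exact: idealMl | exact: idealMl | rewrite mulrDr].
- move=> r _ [x [y [Ix Jy ->]]]; exists (x * r), (y * r).
  by split; [exact: idealMr | exact: idealMr | rewrite mulrDl].
Qed.

Lemma prime_radical_ideal (R : pzRingType) : two_sided_ideal (@prime_radical R).
Proof.
split=> [P [idP _ _]|x y Rx Ry P pP|r x Rx P pP|r x Rx P pP].
- exact: ideal0.
- by case: (pP) => idP _ _; apply: idealB => //; [apply: Rx | apply: Ry].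
- by case: (pP) => idP _ _; apply: idealMl => //; apply: Rx.
- by case: (pP) => idP _ _; apply: idealMr => //; apply: Rx.
Qed.

(** Zorn's lemma, with the condition [I 0] dropped from the family of sets so that
    the empty chain causes no trouble: a maximal member is nonempty, as the zero
    ideal belongs to the family. *)
Lemma maximal_ideal_avoiding_powers (R : pzRingType) (x : R) :
  ~ nilpotent_elt x ->
  exists P : R -> Prop,
    [/\ two_sided_ideal P, (forall n, ~ P (x ^+ n)) &
        forall K : R -> Prop, two_sided_ideal K -> (forall y, P y -> K y) ->
          (exists y, K y /\ ~ P y) -> exists n, K (x ^+ n)].
Proof.
move=> nx.
pose Fam (A : R -> Prop) :=
  [/\ forall y z, A y -> A z -> A (y - z), forall r y, A y -> A (r * y),
      forall r y, A y -> A (y * r) & forall n, ~ A (x ^+ n)].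
have [F FFam Ftot|P [[PB PMl PMr Pn] Pmax]] :=
    @classical_sets.Zorn_bigcup R Fam.
  split=> [y z [A FA Ay] [B FB Bz]|r y [A FA Ay]|r y [A FA Ay]|n [A FA]].
  - have [AB|BA] := Ftot A B FA FB.
      by exists B => //; have [+ _ _ _] := FFam _ FB; apply=> //; apply: AB.
    by exists A => //; have [+ _ _ _] := FFam _ FA; apply=> //; apply: BA.
  - by exists A => //; have [_ + _ _] := FFam _ FA; apply.
  - by exists A => //; have [_ _ + _] := FFam _ FA; apply.
  - by have [_ _ _] := FFam _ FA; apply.
have P0 : P 0.
  apply: boolp.contrapT => nP0; apply: (Pmax (fun y => y = 0)).
    split=> [y Py|/(_ 0 erefl)//].
    by case: nP0; rewrite -(subrr y); apply: PB.
  split=> [_ _ -> ->|r _ ->|r _ ->|n xn0].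
  - by rewrite subr0.
  - by rewrite mulr0.
  - by rewrite mul0r.
  - by apply: nx; exists n.
exists P; split=> // K [K0 KB KMl KMr] PK [y [Ky nPy]].
apply: boolp.contrapT => nK; apply: (Pmax K).
  by split=> // KP; apply: nPy; apply: KP.
by split=> // n Kn; apply: nK; exists n.
Qed.

(** An ideal maximal among those avoiding the powers of [x] is prime: if [I] and
    [J] are not contained in [P], then [P + I] and [P + J] contain powers of [x],
    and the product of these powers lies in [P + IJ]. *)
Lemma prime_radical_nilpotent (R : pzRingType) (x : R) :
  prime_radical x -> nilpotent_elt x.
Proof.
move=> Rx; apply: boolp.contrapT => nx.
have [P [idP Pn Pmax]] := maximal_ideal_avoiding_powers nx.
suff pP : prime_ideal P by apply: (Pn 1); rewrite expr1; apply: Rx.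
split=> // [P1|I J idI idJ IJP]; first exact: (Pn 0).
have pow (K : R -> Prop) : two_sided_ideal K -> ~ (forall y, K y -> P y) ->
    exists n (y z : R), [/\ P y, K z & x ^+ n = y + z].
  move=> idK nKP; apply: (Pmax _ (ideal_add idP idK)) => [y Py|].
    by exists y, 0; split; rewrite ?addr0 //; apply: ideal0.
  apply: boolp.contrapT => nex; apply: nKP => y Ky.
  apply: boolp.contrapT => nPy; apply: nex; exists y; split=> //.
  by exists 0, y; split; rewrite ?add0r //; apply: ideal0.
apply: boolp.contrapT => nIJ.
have [||m [p [i [Pp Ii xm]]]] := pow I => //; first by move=> ?; apply: nIJ; left.
have [||n [q [j [Pq Jj xn]]]] := pow J => //; first by move=> ?; apply: nIJ; right.
apply: (Pn (m + n)%N); rewrite exprD xm xn mulrDl.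
apply: idealD => //; first exact: idealMr.
by rewrite mulrDr; apply: idealD => //; [apply: idealMl | apply: IJP].
Qed.

(** * Coefficients in monoid rings *)

Definition coefs_in (R : pzRingType) (M : monoidType) (I : R -> Prop)
  (a : monoid_ring R M) : Prop := forall g, I a@_g.

Section Coefficients.
Context (R : pzRingType) (M : monoidType).
Implicit Types (a b : monoid_ring R M) (x : R) (g h k : M) (A B : {fset M}).

Lemma mcoeff_sum (T : Type) (r : seq T) (F : T -> monoid_ring R M) k :
  (\sum_(i <- r) F i)@_k = \sum_(i <- r) (F i)@_k.
Proof.
apply: (big_morph (fun a : monoid_ring R M => a@_k)) => [a b|].
  exact: mcoeffD.
exact: mcoeff0.
Qed.

Lemma mcoeff_mulrn a n k : (a *+ n)@_k = a@_k *+ n.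
Proof. exact: mcoeffMn. Qed.

Lemma monoid_ringE a : a = \sum_(g <- msupp a) (<< a@_g *g g >> : monoid_ring R M).
Proof. exact: monalgE. Qed.

(** The freedom in [A] and [B] lets coefficients of several products be written
    as sums over common index sets, so that the sums can be exchanged. *)
Lemma mcoeff_mulw A B a b k : msupp a `<=` A -> msupp b `<=` B ->
  (a * b)@_k = \sum_(g <- A) \sum_(h <- B) (a@_g * b@_h) *+ ((g * h)%g == k).
Proof.
move=> sA sB; rewrite [a * b](monoid_ring_mulw sA sB) mcoeff_sum.
apply: eq_bigr => g _; rewrite mcoeff_sum.
by apply: eq_bigr => h _; rewrite /= mcoeffU.
Qed.

Definition mconst x : monoid_ring R M := << x *g 1%g >>.

Definition mmonom g : monoid_ring R M := << 1 *g g >>.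

Lemma mconstM x y : mconst x * mconst y = mconst (x * y).
Proof. by rewrite [LHS]monoid_ring_mulUU mulg1. Qed.

Lemma mconst_monom x g : mconst x * mmonom g = << x *g g >>.
Proof. by rewrite [LHS]monoid_ring_mulUU mulr1 mul1g. Qed.

Lemma mcoeff_mconstM x a g : (mconst x * a)@_g = x * a@_g.
Proof.
rewrite (mcoeff_mulw _ msuppU_le (fsubset_refl _)) big_seq_fset1 mcoeffUU.
rewrite [in RHS](monoid_ringE a) mcoeff_sum mulr_sumr; apply: eq_bigr => h _ /=.
by rewrite mul1g mcoeffU mulrnAr.
Qed.

Lemma mcoeff_mulmconst x a g : (a * mconst x)@_g = a@_g * x.
Proof.
rewrite (mcoeff_mulw _ (fsubset_refl _) msuppU_le).
rewrite [in RHS](monoid_ringE a) mcoeff_sum mulr_suml; apply: eq_bigr => h _ /=.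
by rewrite big_seq_fset1 mcoeffUU mulg1 mcoeffU mulrnAl.
Qed.

Lemma coefs_in_mul (I : R -> Prop) a b : two_sided_ideal I ->
  (forall g h, I (a@_g * b@_h)) -> coefs_in I (a * b).
Proof.
move=> idI Iab k.
rewrite (mcoeff_mulw _ (fsubset_refl _) (fsubset_refl _)).
by do 2![apply: ideal_sum => // ? _]; apply: ideal_mulrb.
Qed.

Lemma coefs_in_ideal (I : R -> Prop) :
  two_sided_ideal I -> two_sided_ideal (@coefs_in R M I).
Proof.
move=> idI; split=> [g|a b Ia Ib g|a b Ib|a b Ib].
- by rewrite mcoeff0; apply: ideal0.
- by rewrite mcoeffB; apply: idealB.
- by apply: coefs_in_mul => // g h; apply: idealMl.
- by apply: coefs_in_mul => // g h; apply: idealMr.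
Qed.

(** The elements of [M] commute with the constants in [R[M]], so an ideal of
    [R[M]] containing the constants [I J] contains [I[M] J[M]]; primality is
    tested on these two ideals. *)
Lemma prime_ideal_contraction (P : monoid_ring R M -> Prop) :
  prime_ideal P -> prime_ideal (fun x => P (mconst x)).
Proof.
move=> [idP P1 pP]; split=> //.
  split=> [|x y Px Py|r x Px|r x Px]; rewrite /mconst.
  - by rewrite monalgU0; exact: (ideal0 idP).
  - by rewrite monalgUB; exact: (idealB idP).
  - by rewrite -/(mconst _) -mconstM; apply: idealMl.
  - by rewrite -/(mconst _) -mconstM; apply: idealMr.
move=> I J idI idJ IJP.
have mconst_in (K : R -> Prop) x : two_sided_ideal K -> K x -> coefs_in K (mconst x).
  by move=> idK Kx g; rewrite mcoeffU; apply: ideal_mulrb.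
have [a b Ia Jb|sub|sub] := pP _ _ (coefs_in_ideal idI) (coefs_in_ideal idJ).
- rewrite [a * b](monoid_ring_mulw (fsubset_refl _) (fsubset_refl _)).
  apply: (ideal_sum idP) => g _; apply: (ideal_sum idP) => h _.
  by rewrite -mconst_monom; apply: idealMr => //; apply: IJP.
- by left=> x Ix; apply: sub; apply: mconst_in.
- by right=> x Jx; apply: sub; apply: mconst_in.
Qed.

Lemma prime_radical_coefs a : coefs_in (@prime_radical R) a -> prime_radical a.
Proof.
move=> Ja P pP; have [idP _ _] := pP.
rewrite [a]monoid_ringE; apply: ideal_sum => // g _.
rewrite -mconst_monom; apply: idealMr => //.
exact: (Ja g _ (prime_ideal_contraction pP)).
Qed.

End Coefficients.

(** * Armendariz rings *)

Section Armendariz.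
Context (M : monoidType) (R : pzRingType) (armR : Armendariz M R).
Implicit Types (a b : monoid_ring R M).

Lemma Armendariz_absorb a b g : a * b = 0 -> mconst M a@_g * b = 0.
Proof.
move=> /armR ab0; apply/malgP => h.
by rewrite mcoeff_mconstM mcoeff0 ab0.
Qed.

(** The constant factor [x] accumulates the coefficients already extracted, so that
    the Armendariz property can be applied to one factor at a time. *)
Lemma Armendariz_exp a b n g h x :
  mconst M x * (a * b) ^+ n = 0 -> x * (a@_g * b@_h) ^+ n = 0.
Proof.
elim: n x => [|n IHn] x.
  rewrite !expr0 !mulr1 => /malgP/(_ 1%g).
  by rewrite mcoeffUU mcoeff0.
rewrite !exprS -[a * b * _]mulrA mulrA => /(@Armendariz_absorb _ _ g).
rewrite mcoeff_mconstM mulrA => /(@Armendariz_absorb _ _ h).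
by rewrite mcoeff_mconstM => /IHn; rewrite !mulrA.
Qed.

Lemma two_primal_lower_nil_Armendariz : two_primal R -> lower_nil_Armendariz M R.
Proof.
move=> primR a b Jab g h.
have [n abn] := prime_radical_nilpotent (prime_radical_coefs Jab).
apply/primR; exists n; rewrite -[LHS]mul1r.
by apply: Armendariz_exp; rewrite abn mulr0.
Qed.

End Armendariz.

(** * Unique product monoids *)

Definition reduced_mod (T : pzRingType) (J : T -> Prop) : Prop :=
  forall x, J (x * x) -> J x.

Lemma reduced_mod_exp (T : pzRingType) (J : T -> Prop) x n :
  two_sided_ideal J -> reduced_mod J -> J (x ^+ n) -> J x.
Proof.
move=> idJ redJ Jxn.
have: J (x ^+ (2 ^ n)).
  by rewrite -(subnK (ltnW (ltn_expl n (ltnSn 1)))) exprD; apply: idealMl.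
elim: (n) => [|m IHm]; first by rewrite expn0 expr1.
by rewrite expnS mul2n -addnn exprD => /redJ.
Qed.

Lemma reduced_mod_mulC (T : pzRingType) (J : T -> Prop) x y :
  two_sided_ideal J -> reduced_mod J -> J (x * y) -> J (y * x).
Proof.
move=> idJ redJ Jxy; apply: redJ; rewrite mulrA.
by apply: idealMr => //; rewrite -mulrA; apply: idealMl.
Qed.

Lemma two_primal_reduced (R : pzRingType) :
  two_primal R -> reduced_mod (@prime_radical R).
Proof.
move=> primR x /primR[n xn0]; apply/primR; exists (2 * n)%N.
by rewrite exprM expr2.
Qed.

(** Induction on the sizes of the supports [A] and [B] of [a] and [b] modulo [J].
    A unique product [g0 h0] gives [a@_g0 * b@_h0] in [J].  Then [b * a@_g0] has
    lost [h0] from its support, so by induction [a@_g0 * b@_h * a@_g0] is in [J],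
    whence [a@_g0 * b@_h] is in [J] for all [h]; so the term of [a] at [g0] can be
    removed as well. *)
Lemma up_Armendariz_mod (T : pzRingType) (N : monoidType) (J : T -> Prop)
    (a b : monoid_ring T N) :
  up_monoid N -> two_sided_ideal J -> reduced_mod J ->
  coefs_in J (a * b) -> forall g h, J (a@_g * b@_h).
Proof.
move=> upN idJ redJ.
have suppP (c : monoid_ring T N) g : g \notin msupp c -> J c@_g.
  by move=> /mcoeff_outdom ->; apply: ideal0.
move: (msupp a) (msupp b) (suppP a) (suppP b) => A B.
have [n] := ubnP (#|` A| + #|` B|).
elim: n => // n IHn in A B a b *; rewrite ltnS => leABn JA JB Jab.
have [A0|[g1 Ag1]] := fset_0Vmem A.
  by move=> g h; apply: idealMr => //; apply: JA; rewrite A0.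
have [B0|[h1 Bh1]] := fset_0Vmem B.
  by move=> g h; apply: idealMl => //; apply: JB; rewrite B0.
have [||k [[g0 h0] /= [[Ag0 Bh0 kE] uniq_gh]]] := upN A B.
- by apply/fset0Pn; exists g1.
- by apply/fset0Pn; exists h1.
have J00 : J (a@_g0 * b@_h0).
  have Jterm g h : (g, h) != (g0, h0) -> J ((a@_g * b@_h) *+ ((g * h)%g == k)).
    move=> ne; apply: ideal_mulrb => // /eqP ghk.
    have [Ag|/JA Jg] := boolP (g \in A); last exact: idealMr.
    have [Bh|/JB Jh] := boolP (h \in B); last exact: idealMl.
    by case/eqP: ne; symmetry; apply: uniq_gh.
  have Ug0 : g0 \in msupp a `|` A by rewrite inE Ag0 orbT.
  have Uh0 : h0 \in msupp b `|` B by rewrite inE Bh0 orbT.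
  have Jg0 : J (\sum_(h <- msupp b `|` B) (a@_g0 * b@_h) *+ ((g0 * h)%g == k)).
    have := Jab k; rewrite (mcoeff_mulw _ (fsubsetUl _ A) (fsubsetUl _ B)).
    apply: (ideal_sum_isolate idJ Ug0) => g ne; apply: (ideal_sum idJ) => h _.
    by apply: Jterm; rewrite xpair_eqE negb_and ne.
  suff: J ((a@_g0 * b@_h0) *+ ((g0 * h0)%g == k)) by rewrite -kE eqxx.
  apply: (ideal_sum_isolate idJ Uh0 _ Jg0) => h ne.
  by apply: Jterm; rewrite xpair_eqE negb_and ne orbT.
have ltA : (#|` A `\ g0| < #|` A|)%N by rewrite [ltnRHS](cardfsD1 g0) Ag0.
have ltB : (#|` B `\ h0| < #|` B|)%N by rewrite [ltnRHS](cardfsD1 h0) Bh0.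
have J0 h : J (a@_g0 * b@_h).
  have Jaba : J (a@_g0 * (b * mconst N a@_g0)@_h).
    apply: (IHn A (B `\ h0)) => // [|h'|g'].
    - by apply: leq_trans leABn; rewrite ltn_add2l.
    - rewrite mcoeff_mulmconst !inE negb_and negbK.
      case/orP=> [/eqP ->|/JB Jh']; last exact: idealMr.
      exact: reduced_mod_mulC.
    - by rewrite mulrA mcoeff_mulmconst; apply: idealMr.
  rewrite mcoeff_mulmconst in Jaba.
  by apply: redJ; rewrite mulrA -[X in X * _]mulrA; apply: idealMr.
pose a' : monoid_ring T N := a - << a@_g0 *g g0 >>.
have a'E g : a'@_g = a@_g - a@_g0 *+ (g0 == g) by rewrite mcoeffB mcoeffU.
have Ja'b g h : J (a'@_g * b@_h).
  apply: (IHn (A `\ g0) B) => // [|g'|].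
  - by apply: leq_trans leABn; rewrite ltn_add2r.
  - rewrite a'E !inE negb_and negbK eq_sym.
    case: eqVneq => [<- _|_ /= /JA]; last by rewrite subr0.
    by rewrite subrr; apply: ideal0.
  - rewrite mulrBl; apply: (idealB (coefs_in_ideal N idJ)) => //.
    apply: coefs_in_mul => // g' h'; rewrite mcoeffU mulrnAl.
    by apply: ideal_mulrb.
move=> g h; have := Ja'b g h; rewrite a'E.
by case: eqVneq => [<- _|_]; [apply: J0 | rewrite subr0].
Qed.

(** With [J] the prime radical of [R], the quotient [R[N] / J[N]] is reduced, so
    [J[N]] contains all nilpotent elements of [R[N]], in particular its prime
    radical. *)
Lemma prime_radical_up (N : monoidType) (R : pzRingType) (a : monoid_ring R N) :
  up_monoid N -> two_primal R ->
  prime_radical a -> coefs_in (@prime_radical R) a.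
Proof.
move=> upN primR /prime_radical_nilpotent[n an0].
have idJ := prime_radical_ideal R; have idJN := coefs_in_ideal N idJ.
have redJ := two_primal_reduced primR.
have redJN : reduced_mod (@coefs_in R N (@prime_radical R)).
  by move=> b Jbb g; apply: (redJ); apply: (up_Armendariz_mod upN idJ redJ Jbb).
have Jan : coefs_in (@prime_radical R) (a ^+ n) by rewrite an0; apply: (ideal0 idJN).
exact: reduced_mod_exp idJN redJN Jan.
Qed.

(** * Exchanging two monoids of exponents *)

Section Swap.
Context (R : pzRingType).
Local Notation iter_ring M N := (monoid_ring (monoid_ring R N) M).

Definition malg_swap (M N : monoidType) (a : iter_ring M N) : iter_ring N M :=
  \sum_(g <- msupp a) \sum_(s <- msupp a@_g) 
    << (<< a@_g@_s *g g >> : monoid_ring R M) *g s >>.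

Context (M N : monoidType).
Implicit Types (a b : iter_ring M N) (g h k : M) (s t u : N).

Lemma mcoeff_swap a s g : (malg_swap a)@_s@_g = a@_g@_s.
Proof.
transitivity (\sum_(g' <- msupp a) a@_g'@_s *+ (g' == g)).
  rewrite !mcoeff_sum; apply: eq_bigr => g' _.
  rewrite !mcoeff_sum [in RHS](monoid_ringE a@_g') mcoeff_sum -sumrMnl.
  by apply: eq_bigr => s' _; rewrite !mcoeffU mcoeff_mulrn mcoeffU mulrnAC.
rewrite [in RHS](monoid_ringE a) !mcoeff_sum.
by apply: eq_bigr => g' _; rewrite mcoeffU mcoeff_mulrn.
Qed.

Lemma msupp_swap_inner a g : msupp a@_g `<=` msupp (malg_swap a).
Proof.
apply/fsubsetP => s; rewrite -!mcoeff_neq0 -mcoeff_swap.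
by apply: contra_neq => ->; rewrite mcoeff0.
Qed.

Lemma msupp_swap_coef a s : msupp (malg_swap a)@_s `<=` msupp a.
Proof.
apply/fsubsetP => g; rewrite -!mcoeff_neq0 mcoeff_swap.
by apply: contra_neq => ->; rewrite mcoeff0.
Qed.

Lemma malg_swapM a b : malg_swap (a * b) = malg_swap a * malg_swap b.
Proof.
apply/malgP => u; apply/malgP => k; rewrite mcoeff_swap.
rewrite !(mcoeff_mulw _ (fsubset_refl _) (fsubset_refl _)) !mcoeff_sum /=.
pose F g h s t := a@_g@_s * b@_h@_t *+ ((g * h)%g == k) *+ ((s * t)%g == u).
transitivity (\sum_(g <- msupp a) \sum_(h <- msupp b)
  \sum_(s <- msupp (malg_swap a)) \sum_(t <- msupp (malg_swap b)) F g h s t).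
  apply: eq_bigr => g _; rewrite mcoeff_sum; apply: eq_bigr => h _ /=.
  rewrite mcoeff_mulrn (mcoeff_mulw _ (msupp_swap_inner _ _) (msupp_swap_inner _ _)).
  rewrite -sumrMnl; apply: eq_bigr => s _; rewrite -sumrMnl.
  by apply: eq_bigr => t _; rewrite mulrnAC.
under [LHS]eq_bigr => g _ do rewrite exchange_big /=.
rewrite exchange_big /=; apply: eq_bigr => s _; rewrite mcoeff_sum.
under [LHS]eq_bigr => g _ do rewrite exchange_big /=.
rewrite exchange_big /=; apply: eq_bigr => t _.
rewrite mcoeff_mulrn (mcoeff_mulw _ (msupp_swap_coef _ _) (msupp_swap_coef _ _)).
rewrite -sumrMnl; apply: eq_bigr => g _; rewrite -sumrMnl.
by apply: eq_bigr => h _; rewrite !mcoeff_swap.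
Qed.

End Swap.

(** * Lower nil Armendariz monoid rings *)

Theorem proposition3p4 (M N : monoidType) (R : pzRingType) :
  up_monoid N -> two_primal R -> Armendariz M R ->
  lower_nil_Armendariz M (monoid_ring R N).
Proof.
move=> upN primR armR a b Jab g h.
have nilR := two_primal_lower_nil_Armendariz armR primR.
have idJ := prime_radical_ideal R; have idJM := coefs_in_ideal M idJ.
have redJM : reduced_mod (@coefs_in R M (@prime_radical R)).
  by move=> c Jcc k; apply: two_primal_reduced => //; apply: nilR.
have Jswap : coefs_in (coefs_in (@prime_radical R)) (malg_swap a * malg_swap b).
  move=> u k; rewrite -malg_swapM mcoeff_swap.
  exact: prime_radical_up (Jab k) u.
apply: prime_radical_coefs; apply: coefs_in_mul => // s t.
rewrite -!(mcoeff_swap _ _ g) -!(mcoeff_swap _ _ h).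
by apply: nilR; apply: (up_Armendariz_mod upN idJM redJM Jswap s t).
Qed.
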